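(* Let $\mathcal{A}$ be a unital complex Banach $*$-algebra with proper involution, and let $a,b\in\mathcal{A}$. Then the following are equivalent: (1) $a\in\mathcal{A}_{b,b}^{\mathrm{gg}}$. (2) $a\in\mathcal{A}^{\mathrm{gg}}$, $b\in\mathcal{A}^{\#}$ and $aa^{\mathrm{gg}}=bb^{\#}$. (3) $a,ab\in\mathcal{A}^{\mathrm{gg}}$, $b\in\mathcal{A}^{\#}$, $a^{\mathrm{gg}}\mathcal{A}=b\mathcal{A}$ and $(ab)^{\mathrm{gg}}=b^{\mathrm{gg}}a^{\mathrm{gg}}$.
   Context: An involution on a complex Banach algebra $\mathcal{A}$ is a map $x\mapsto x^*$ with $(x+y)^*=x^*+y^*$, $(\lambda x)^*=\overline{\lambda}x^*$, $(xy)^*=y^*x^*$, $(x^* )^*=x$; it is proper if $x^*x=0$ implies $x=0$. Group inverse: $a\in\mathcal{A}^{\#}$ if there is $x$ with $ax^2=x$, $ax=xa$, $xa^2=a$; it is unique, denoted $a^{\#}$. $(b,c)$-inverse: $a$ has a $(b,c)$-inverse if there is $x$ with $xab=b$, $cax=c$, $x\in b\mathcal{A}x\cap x\mathcal{A}c$; it is unique, denoted $a^{(b,c)}$. Generalized group inverse: $a\in\mathcal{A}^{\mathrm{gg}}$ if there is $x$ with $x=ax^2$, $(a^*a^2x)^*=a^*a^2x$, $\lim_{n\to\infty}\|a^n-xa^{n+1}\|^{1/n}=0$; it is unique, denoted $a^{\mathrm{gg}}$. (Every group invertible element is generalized group invertible.) $\mathcal{A}_{b,c}^{\mathrm{gg}}$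 is the set of $a\in\mathcal{A}^{\mathrm{gg}}$ such that $a^{(b,c)}$ exists and $a^{\mathrm{gg}}=a^{(b,c)}$; $\mathcal{A}_{b,b}^{\mathrm{gg}}$ is the case $c=b$. *)

(* Defs.v *)
From HB Require Import structures.
From mathcomp Require Import all_boot all_order all_algebra.
From mathcomp Require Import complex.
From mathcomp Require Import all_classical all_reals all_analysis.

Set Implicit Arguments.
Unset Strict Implicit.
Unset Printing Implicit Defensive.

Import Order.TTheory GRing.Theory Num.Theory.
Import numFieldNormedType.Exports.

Local Open Scope classical_set_scope.
Local Open Scope ring_scope.

(* Unital Banach algebras. Hierarchy-Builder rejects a structure joining      *)
(* CompleteNormedModule and GRing.Algebra (there is no common join with       *)
(* Num.NumDomain), so the product is added to a completeNormedModType by a    *)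
(* record whose carrier then receives both canonical structures. The unit is  *)
(* not required to have norm 1.                                               *)
Record banachAlg (K : numFieldType) := BanachAlg {
  banach_space : completeNormedModType K;
  banach_one : banach_space;
  banach_mul : banach_space -> banach_space -> banach_space;
  banach_mulA : associative banach_mul;
  banach_mul1 : left_id banach_one banach_mul;
  banach_mulr1 : right_id banach_one banach_mul;
  banach_mulDl : left_distributive banach_mul +%R;
  banach_mulDr : right_distributive banach_mul +%R;
  banach_one_neq0 : banach_one != 0;
  banach_scaleAl : forall (k : K) x y,
    k *: banach_mul x y = banach_mul (k *: x) y;
  banach_scaleAr : forall (k : K) x y,
    k *: banach_mul x y = banach_mul x (k *: y);
  banach_normM : forall x y, `|banach_mul x y| <= `|x| * `|y|
}.

Definition banach_sort (K : numFieldType) (A : banachAlg K) : Type :=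
  banach_space A.

Coercion banach_sort : banachAlg >-> Sortclass.

HB.instance Definition _ (K : numFieldType) (A : banachAlg K) :=
  CompleteNormedModule.on (banach_sort A).

HB.instance Definition _ (K : numFieldType) (A : banachAlg K) :=
  GRing.Zmodule_isNzRing.Build (banach_sort A)
    (@banach_mulA K A) (@banach_mul1 K A) (@banach_mulr1 K A)
    (@banach_mulDl K A) (@banach_mulDr K A) (@banach_one_neq0 K A).

HB.instance Definition _ (K : numFieldType) (A : banachAlg K) :=
  GRing.Lmodule_isLalgebra.Build K (banach_sort A) (@banach_scaleAl K A).

HB.instance Definition _ (K : numFieldType) (A : banachAlg K) :=
  GRing.Lalgebra_isAlgebra.Build K (banach_sort A) (@banach_scaleAr K A).

(* The norm of a K-module takes values in K; for K = R[i] it is real, and     *)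
(* real_norm is the same norm as an element of R.                             *)
Definition real_norm (R : realType) (A : banachAlg R[i]) (x : A) : R :=
  complex.Re `|x|.

(* Neither isometry nor continuity of the involution is required.             *)
Record is_involution (R : realType) (A : banachAlg R[i]) (star : A -> A) :
    Prop := IsInvolution {
  starD : forall x y, star (x + y) = star x + star y;
  starZ : forall (l : R[i]) x, star (l *: x) = l^* *: star x;
  starM : forall x y, star (x * y) = star y * star x;
  starK : forall x, star (star x) = x
}.

Definition proper_involution (R : realType) (A : banachAlg R[i])
    (star : A -> A) : Prop :=
  forall x, star x * x = 0 -> x = 0.

Section GeneralizedInverses.
Variables (R : realType) (A : banachAlg R[i]).
Implicit Types (a b c x : A) (star : A -> A).

Definition is_group_inverse a x : Prop :=
  [/\ a * x ^+ 2 = x, a * x = x * a & x * a ^+ 2 = a].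

Definition group_invertible : set A := [set a | exists x, is_group_inverse a x].

(* Here and below the inverse takes the default value 0 when none exists.     *)
Definition group_inverse a : A := xget 0 [set x | is_group_inverse a x].

Definition is_bc_inverse b c a x : Prop :=
  [/\ x * a * b = b, c * a * x = c,
      exists y, x = b * y * x & exists y, x = x * y * c].

Definition bc_invertible b c : set A :=
  [set a | exists x, is_bc_inverse b c a x].

Definition bc_inverse b c a : A := xget 0 [set x | is_bc_inverse b c a x].

(* The exponent n%:R^-1 is the junk value 0 at n = 0, which does not affect   *)
(* the limit.                                                                 *)
Definition is_gg_inverse star a x : Prop :=
  [/\ x = a * x ^+ 2,
      star (star a * a ^+ 2 * x) = star a * a ^+ 2 * x &
      real_norm (a ^+ n - x * a ^+ n.+1) `^ (n%:R^-1) @[n --> \oo] --> (0 : R)].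

Definition gg_invertible star : set A :=
  [set a | exists x, is_gg_inverse star a x].

Definition gg_inverse star a : A := xget 0 [set x | is_gg_inverse star a x].

Definition gg_bc_invertible star b c : set A :=
  [set a | [/\ gg_invertible star a, bc_invertible b c a &
               gg_inverse star a = bc_inverse b c a]].

Definition right_ideal a : set A := range (fun y => a * y).

End GeneralizedInverses.

Arguments group_invertible {R A}.

(* Main.v *)
Require Import Defs.
From mathcomp Require Import all_boot all_order all_algebra.
From mathcomp Require Import complex.
From mathcomp Require Import all_classical all_reals all_analysis.

Import Order.TTheory GRing.Theory Num.Theory.
Import numFieldNormedType.Exports.

(** Let [x] be a generalized group inverse of [a]. The proof rests on three
    facts.

    - The limit condition is only ever used through exact identities: if
      [y = a * y ^+ 2] then [a * y] is [a ^+ n * y ^+ n] for every positive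
      [n], so [a * y - x * a * (a * y)] is [(a ^+ n - x * a ^+ n.+1) * y ^+ n].
      The norm of the latter is at most (e_n |y|)^n with e_n tending to 0, and
      hence [x * a * (a * y) = a * y] ([gg_absorb]). In particular
      [p = a * x] is an idempotent, [x * a * x = x], and [p] and [x] span the
      same right ideal.
    - The symmetry condition says that [p] is self-adjoint for the form given
      by [star a * a], that is,
      [star p * (star a * a) = star a * a * p] ([gg_selfadj]).
    - Two idempotents with one range that are self-adjoint for the same form
      [star c * c] agree after left multiplication by [c], because the
      involution is proper ([proper_cancel]).

    Together they give uniqueness of the generalized group inverse, so that the
    function choosing one returns any given witness.

    For the first equivalence, [x] is the (b, b)-inverse of [a] exactly when
    [p] is a two-sided unit for [b] lying in both [b A] and [A b]. This makes
    [b] invertible in the corner [p A p], and the inverse there is the group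
    inverse [g] of [b], with [b * g = p].

    For the second one, put [c = a * b] and [e = b * g]. If [p = e] then
    [g * x] is a genuine group inverse of [c]. Conversely [p] and [e] have the
    same range, [c * e = c] and [c * (g * x) = p]. Self-adjointness of [p] for
    the form of [c] then forces [c * p = c * e], and multiplying by [g * x] on
    the left turns this into [e * p = e], while [e * p = p]
    ([gg_product_projection]). *)

Local Open Scope classical_set_scope.
Local Open Scope ring_scope.

(** * The norm and the root test *)

Section RootTest.
Context {R : realType} {A : banachAlg R[i]}.
Implicit Types x y z w : A.

Lemma real_normE x : (real_norm x)%:C%C = `|x|.
Proof. by rewrite /real_norm RRe_real // normr_real. Qed.

Lemma real_norm_ge0 x : 0 <= real_norm x.
Proof. by rewrite -ler0c real_normE. Qed.

Lemma real_norm0_eq0 x : real_norm x = 0 -> x = 0.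
Proof. by move=> h; apply/normr0_eq0; rewrite -real_normE h. Qed.

Lemma real_normM x y : real_norm (x * y) <= real_norm x * real_norm y.
Proof. by rewrite -lecR rmorphM /= !real_normE; exact: banach_normM. Qed.

(** Keeping the factor [x] in front makes the bound hold at [n = 0] although
    the norm of the unit may exceed 1. *)
Lemma real_normMX x y n :
  real_norm (x * y ^+ n) <= real_norm x * real_norm y ^+ n.
Proof.
elim: n => [|n IHn]; first by rewrite !expr0 !mulr1.
rewrite !exprSr !mulrA (le_trans (real_normM _ _)) //.
by rewrite ler_wpM2r // real_norm_ge0.
Qed.

(** Eventually |u_n| <= e^n for any prescribed e > 0; with
    e = 1 / (2 (|w| + 1)) this gives |z| <= |u_n| |w|^n <= 2^-n. The identity is
    asked for positive exponents only, because [a ^+ n * y ^+ n = a * y] fails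
    at [n = 0] in the intended application. *)
Lemma root_null_eq0 {u : nat -> A} {w z} :
  real_norm (u n) `^ (n%:R^-1) @[n --> \oo] --> (0 : R) ->
  (forall n, u n.+1 * w ^+ n.+1 = z) -> z = 0.
Proof.
move=> u0 uz; apply: real_norm0_eq0; apply/eqP; rewrite eq_le real_norm_ge0 andbT.
have W0 : 0 < real_norm w + 1 by rewrite ltr_wpDl // real_norm_ge0.
pose e := 2^-1 / (real_norm w + 1).
have e0 : 0 < e by rewrite divr_gt0 // invr_gt0.
have half : (2^-1 : R) ^+ n @[n --> \oo] --> (0 : R).
  by apply: cvg_expr; rewrite ger0_norm ?invr_ge0 // invf_lt1 // ltr1n.
rewrite -(cvg_lim _ half) //.
apply: limr_ge; first by apply/cvg_ex; exists 0.
near=> n.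
have n0 : (0 < n)%N by near: n; exists 1%N.
have une : real_norm (u n) `^ (n%:R^-1) < e.
  by near: n; exact: (@cvgr_lt _ _ _ _ _ _ u0).
have une' : real_norm (u n) <= e ^+ n.
  have /(lerXn2r n) := ltW une.
  rewrite -powR_mulrn ?powR_ge0 // -powRrM mulVf ?pnatr_eq0 -?lt0n //.
  by rewrite powRr1 ?real_norm_ge0 //; apply; rewrite nnegrE ?powR_ge0 // ltW.
have -> : z = u n * w ^+ n by rewrite -(uz n.-1) prednK.
rewrite (le_trans (real_normMX _ _ _)) //.
apply: (@le_trans _ _ (e ^+ n * (real_norm w + 1) ^+ n)).
  rewrite ler_pM ?exprn_ge0 ?real_norm_ge0 //.
  by rewrite lerXn2r ?nnegrE ?real_norm_ge0 ?(ltW W0) // lerDl.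
by rewrite -exprMn /e divfK // gt_eqF.
Unshelve. all: by end_near.
Qed.

End RootTest.

(** * Group inverses and (b, c)-inverses *)

Section GroupInverse.
Context {R : realType} {A : banachAlg R[i]}.
Implicit Types a b c g p u v x y : A.

Lemma group_inverse_inner {a x} : is_group_inverse a x -> a * x * a = a.
Proof. by move=> [_ axC xaa]; rewrite axC -mulrA -expr2. Qed.

Lemma group_inverse_outer {a x} : is_group_inverse a x -> x * a * x = x.
Proof. by move=> [axx axC _]; rewrite -axC -mulrA -expr2. Qed.

(** The idempotents [a * x] and [a * y] coincide, since each of them is a
    two-sided unit for [a]; an outer inverse commuting with [a] is determined
    by its idempotent. *)
Lemma group_inverse_unique {a x y} :
  is_group_inverse a x -> is_group_inverse a y -> x = y.
Proof.
move=> ax ay; have [_ axC xaa] := ax; have [_ ayC _] := ay.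
have e : a * x = a * y.
  rewrite axC -[in LHS](group_inverse_inner ay) -mulrA -ayC !mulrA.
  by rewrite -[x * a * a]mulrA -expr2 xaa.
rewrite -(group_inverse_outer ax) -axC e.
by rewrite ayC -mulrA e mulrA (group_inverse_outer ay).
Qed.

(** Both inverses equal [y * a * x]: the membership of [x] in [b A x] lets
    [y * a] act as the identity on its left, and that of [y] in [y A c] lets
    [a * x] act as the identity on its right. *)
Lemma bc_inverse_unique {b c a x y} :
  is_bc_inverse b c a x -> is_bc_inverse b c a y -> x = y.
Proof.
move=> [_ cax [u xu] _] [yab _ _ [v yv]].
have -> : x = y * a * x by rewrite {2}xu !mulrA yab -xu.
by rewrite {1}yv -[y * v * c * a]mulrA -mulrA cax -yv.
Qed.

(** An element with unit [p] and one-sided inverses modulo [p] is invertible in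
    the corner ring [p A p]; the inverse in that corner is its group inverse. *)
Lemma group_inverse_of_idempotent {b p u v} :
  b * p = b -> p * b = b -> b * u = p -> v * b = p ->
  exists2 g, is_group_inverse b g & b * g = p.
Proof.
move=> bp pb bu vb.
have pp : p * p = p by rewrite -{1}vb -mulrA bp.
have bg : b * (p * u * p) = p by rewrite !mulrA bp bu.
have gb : p * u * p * b = p.
  (* The right inverse [u] and the left inverse [v] agree in the corner. *)
  rewrite -mulrA pb.
  have -> : p * u = v * p by rewrite -[in LHS]vb -mulrA bu.
  by rewrite -mulrA pb vb.
exists (p * u * p) => //; split.
- by rewrite expr2 mulrA bg !mulrA pp.
- by rewrite bg.
- by rewrite expr2 mulrA gb pb.
Qed.

Lemma group_inverseE {a x} : is_group_inverse a x -> group_inverse a = x.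
Proof.
by move=> ax; apply: xget_unique => // y ay;
  exact: group_inverse_unique ay ax.
Qed.

Lemma group_inverseP {a} :
  group_invertible a -> is_group_inverse a (group_inverse a).
Proof. by case=> x ax; rewrite (group_inverseE ax). Qed.

Lemma bc_inverseE {b c a x} : is_bc_inverse b c a x -> bc_inverse b c a = x.
Proof.
by move=> ax; apply: xget_unique => // y ay;
  exact: bc_inverse_unique ay ax.
Qed.

Lemma bc_inverseP {b c a} :
  bc_invertible b c a -> is_bc_inverse b c a (bc_inverse b c a).
Proof. by case=> x ax; rewrite (bc_inverseE ax). Qed.

End GroupInverse.

(** * Generalized group inverses *)

Section GeneralizedGroupInverse.
Context {R : realType} {A : banachAlg R[i]} {star : A -> A}.
Hypothesis star_invol : is_involution star.
Hypothesis star_proper : proper_involution star.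
Implicit Types a b c g p x y z : A.

Let sM := starM star_invol.
Let sK := starK star_invol.

(** Properness makes [star c * c] have the same right annihilator as [c]. *)
Lemma proper_cancel {c y z} : star c * c * y = star c * c * z -> c * y = c * z.
Proof.
move=> h; apply/eqP; rewrite -subr_eq0 -mulrBr; apply/eqP/star_proper.
by rewrite sM -mulrA [star c * _]mulrA mulrBr h subrr mulr0.
Qed.

(** Taking [y = x] shows that [x * a] fixes the range of [a * x]; taking
    another generalized group inverse for [y] is what uniqueness needs. *)
Lemma gg_absorb {a x y} :
  is_gg_inverse star a x -> y = a * y ^+ 2 -> x * a * (a * y) = a * y.
Proof.
move=> [_ _ x0] ayy; apply/esym/eqP; rewrite -subr_eq0; apply/eqP.
apply: (root_null_eq0 (w := y) x0) => n.
have ayX m : a * y ^+ m.+2 = y ^+ m.+1.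
  by rewrite -[m.+2]/(2 + m)%N exprD mulrA -ayy -exprS.
have aXy m : a ^+ m.+1 * y ^+ m.+1 = a * y.
  elim: m => [|m IHm]; first by rewrite !expr1.
  by rewrite [a ^+ _]exprSr -mulrA ayX.
by rewrite mulrBl aXy [a ^+ _.+2]exprS -!mulrA aXy.
Qed.

Lemma gg_outer {a x y} :
  is_gg_inverse star a x -> y = a * y ^+ 2 -> x * a * y = y.
Proof.
move=> ax ayy; rewrite [X in _ * X]ayy expr2 [a * _]mulrA mulrA.
by rewrite (gg_absorb ax ayy) -mulrA -expr2 -ayy.
Qed.

(** [a * x] is self-adjoint for the form given by [star a * a]: this is the
    symmetry axiom with the adjoint of the product expanded. *)
Lemma gg_selfadj {a x} : is_gg_inverse star a x ->
  star (a * x) * (star a * a) = star a * a * (a * x).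
Proof.
case=> _; rewrite expr2 => saax _.
have <- : star a * (a * a) * x = star a * a * (a * x) by rewrite !mulrA.
by rewrite -saax !sM sK !mulrA.
Qed.

(** The idempotents [p = a * x] and [p' = a * y] satisfy [p * p' = p'] and
    [p' * p = p], and both are self-adjoint for [s = star a * a]. Hence
    [s * p'] = [s * p * p'] = [star p * s * p'] = [star p * star p' * s]
    = [star (p' * p) * s] = [s * p]. Properness gives [a * p = a * p'], and the
    left factor [x], which cancels [a] on these ranges, gives [p = p']. *)
Lemma gg_inverse_unique {a x y} :
  is_gg_inverse star a x -> is_gg_inverse star a y -> x = y.
Proof.
move=> ax ay; have [axx _ _] := ax; have [ayy _ _] := ay.
have range z w : w = a * w ^+ 2 -> is_gg_inverse star a z -> z = a * z ^+ 2 ->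
    (a * z) * (a * w) = a * w.
  move=> aww az azz; rewrite -{1}(gg_absorb az aww) !mulrA.
  by rewrite -[a * z * z]mulrA -expr2 -azz -!mulrA mulrA (gg_absorb az aww).
have e : a * (a * x) = a * (a * y).
  apply: proper_cancel.
  rewrite -[in RHS](range _ _ ayy ax axx) [RHS]mulrA -(gg_selfadj ax).
  rewrite -[RHS]mulrA -(gg_selfadj ay) [RHS]mulrA -sM.
  by rewrite (range _ _ axx ay ayy).
have {}e : a * x = a * y.
  by rewrite -(gg_absorb ax axx) -(gg_absorb ax ayy) -!mulrA e.
by rewrite -(gg_outer ay axx) -mulrA e mulrA (gg_outer ay ayy).
Qed.

Lemma gg_inverseE {a x} : is_gg_inverse star a x -> gg_inverse star a = x.
Proof.
by move=> ax; apply: xget_unique => // y ay;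
  exact: gg_inverse_unique ay ax.
Qed.

Lemma gg_inverseP {a} :
  gg_invertible star a -> is_gg_inverse star a (gg_inverse star a).
Proof. by case=> x ax; rewrite (gg_inverseE ax). Qed.

(** When [x * a ^+ 2 = a] the sequence in the limit condition vanishes from
    rank 1 on, so no analysis is left; this covers all genuine group inverses. *)
Lemma gg_of_inverse {a x} : x = a * x ^+ 2 ->
  star (star a * a ^+ 2 * x) = star a * a ^+ 2 * x -> x * a ^+ 2 = a ->
  is_gg_inverse star a x.
Proof.
move=> axx sax xaa; split=> //.
apply: cvg_near_cst; near=> n.
have n0 : (0 < n)%N by near: n; exists 1%N.
have -> : a ^+ n - x * a ^+ n.+1 = 0.
  by rewrite -(prednK n0) -addn2 addnC exprD mulrA xaa -exprS subrr.
by rewrite /real_norm normr0 /= powR0 // invr_neq0 // pnatr_eq0 -lt0n.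
Unshelve. all: by end_near.
Qed.

Lemma group_inverse_gg {a x} : is_group_inverse a x -> is_gg_inverse star a x.
Proof.
move=> [axx axC xaa]; apply: gg_of_inverse => //.
have a2x : a ^+ 2 * x = a by rewrite expr2 -mulrA axC mulrA axC -mulrA -expr2.
by rewrite -mulrA a2x sM sK.
Qed.

(** [a * x] is a two-sided unit for [b], and the factorizations of [x] through
    [b] on the left and on the right put [a * x] in [b A] and in [A b]. *)
Lemma bc_inverse_projection {a b x} : is_gg_inverse star a x ->
  is_bc_inverse b b a x ->
  exists2 g, is_group_inverse b g & a * x = b * g.
Proof.
move=> ax [xab bax [u xu] [v xv]]; have [axx _ _] := ax.
have pb : a * x * b = b.
  rewrite -xab [a * x * _]mulrA [a * x * _]mulrA -[a * x * x]mulrA -expr2.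
  by rewrite -axx.
have [|||g bg <-] := @group_inverse_of_idempotent R A b (a * x)
  (u * x * a * (a * x)) (a * x * v) _ pb.
- by rewrite mulrA.
- by rewrite !mulrA -xu -mulrA (gg_absorb ax axx).
- by rewrite -!mulrA [x * _]mulrA -xv.
by exists g.
Qed.

Lemma projection_bc_inverse {a b x g} : is_gg_inverse star a x ->
  is_group_inverse b g -> a * x = b * g -> is_bc_inverse b b a x.
Proof.
move=> ax bg e; have [axx _ _] := ax; have [_ bgC _] := bg.
have pb := group_inverse_inner bg.
split.
- by rewrite -[in LHS]pb -e mulrA (gg_absorb ax axx) e.
- by rewrite -mulrA e bgC mulrA.
- by exists g; rewrite -e -mulrA -expr2.
- by exists g; rewrite -mulrA -bgC -e mulrA (gg_outer ax axx).
Qed.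

(** With [c = a * b] and [y = g * x], both [c * y] and [y * c] are the common
    idempotent [a * x = b * g], which is a two-sided unit for [c]. *)
Lemma gg_product {a b x g} : is_gg_inverse star a x ->
  is_group_inverse b g -> a * x = b * g ->
  is_gg_inverse star (a * b) (g * x).
Proof.
move=> ax bg e; have [axx _ _] := ax; have [bgg bgC _] := bg.
have [xab bax _ _] := projection_bc_inverse ax bg e.
have cy : a * b * (g * x) = a * x.
  by rewrite -mulrA [b * _]mulrA -e -[a * x * x]mulrA -expr2 -axx.
have yc : g * x * (a * b) = a * x by rewrite -mulrA [x * _]mulrA xab -bgC.
apply: gg_of_inverse.
- by rewrite expr2 mulrA cy e mulrA -[b * g * g]mulrA -expr2 bgg.
- have -> : star (a * b) * (a * b) ^+ 2 * (g * x) = star (a * b) * (a * b).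
    by rewrite expr2 -!mulrA [a * (b * (g * x))]mulrA cy [b * _]mulrA bax.
  by rewrite sM sK.
- (* [a * x] fixes [a * b] on the left because [b = a * x * b]. *)
  rewrite expr2 mulrA yc.
  have {1}-> : b = a * x * b by rewrite e (group_inverse_inner bg).
  rewrite mulrA -!mulrA [x * (a * _)]mulrA [a * (x * b)]mulrA.
  by rewrite [x * a * _]mulrA (gg_absorb ax axx) e (group_inverse_inner bg).
Qed.

(** Write [p = a * x], [e = b * g], [c = a * b] and [s = star c * c]. Equality
    of the right ideals makes [p] and [e] fix each other's range on the left,
    and gives [c * (g * x) = p], so [p] is self-adjoint for [s]. With
    [c * e = c] this gives
    [s * e] = [s * p * e] = [star p * s * e] = [star p * s] = [s * p],
    hence [c * e = c * p]. As [g * x * c = e], this becomes [e = e * p = p]. *)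
Lemma gg_product_projection {a b x g} : is_gg_inverse star a x ->
  is_group_inverse b g -> right_ideal x = right_ideal b ->
  is_gg_inverse star (a * b) (g * x) -> a * x = b * g.
Proof.
move=> ax bg xAbA cy_gg; have [axx _ _] := ax; have [_ bgC _] := bg.
have [v _ xv] : right_ideal x b by rewrite xAbA; exists 1; rewrite ?mulr1.
have [u _ bu] : right_ideal b x by rewrite -xAbA; exists 1; rewrite ?mulr1.
have pb : a * x * b = b by rewrite -xv mulrA -[a * x * x]mulrA -expr2 -axx.
have ex : b * g * x = x by rewrite -bu mulrA (group_inverse_inner bg).
have xab : x * a * b = b by rewrite -[in LHS]pb mulrA (gg_absorb ax axx).
have pe : a * x * (b * g) = b * g by rewrite mulrA pb.
have ep : b * g * (a * x) = a * x.
  by rewrite -(gg_absorb ax axx) !mulrA ex.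
have ce : a * b * (b * g) = a * b.
  by rewrite bgC -mulrA [b * _]mulrA (group_inverse_inner bg).
have cy : a * b * (g * x) = a * x.
  by rewrite -mulrA [b * _]mulrA ex.
have yc : g * x * (a * b) = b * g by rewrite -mulrA [x * _]mulrA xab -bgC.
have ee : b * g * (b * g) = b * g by rewrite mulrA (group_inverse_inner bg).
have sp := gg_selfadj cy_gg; rewrite cy in sp.
have ecp : a * b * (b * g) = a * b * (a * x).
  apply: proper_cancel.
  rewrite -sp -[in LHS]pe [LHS]mulrA -sp -[LHS]mulrA.
  by rewrite -(mulrA _ (a * b) (b * g)) ce.
by rewrite -ep -[in LHS]yc -mulrA -ecp mulrA yc ee.
Qed.

End GeneralizedGroupInverse.

(** * The equivalence *)

Theorem theorem4p10 (R : realType) (A : banachAlg R[i]) (star : A -> A)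
    (star_invol : is_involution star) (star_proper : proper_involution star)
    (a b : A) :
  (a \in gg_bc_invertible star b b <->
   [/\ a \in gg_invertible star, b \in group_invertible &
       a * gg_inverse star a = b * group_inverse b])
  /\
  ([/\ a \in gg_invertible star, b \in group_invertible &
       a * gg_inverse star a = b * group_inverse b] <->
   [/\ a \in gg_invertible star /\ a * b \in gg_invertible star,
       b \in group_invertible,
       right_ideal (gg_inverse star a) = right_ideal b &
       gg_inverse star (a * b) = gg_inverse star b * gg_inverse star a]).
Proof.
have ggP := @gg_inverseP _ _ _ star_invol star_proper.
have ggE := @gg_inverseE _ _ _ star_invol star_proper.
have group_ggE : group_invertible b -> gg_inverse star b = group_inverse b.
  by move=> /group_inverseP/(group_inverse_gg star_invol)/(ggE _ _).
split; split.
- move=> /set_mem[ga gbc exb]; have bcP := bc_inverseP gbc; rewrite -exb in bcP.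
  have [g bg e] := bc_inverse_projection (ggP _ ga) bcP.
  split; [exact: mem_set ga | by apply: mem_set; exists g |].
  by rewrite e (group_inverseE bg).
- move=> [/set_mem ga /set_mem gb e]; apply: mem_set.
  have bc := projection_bc_inverse (ggP _ ga) (group_inverseP gb) e.
  by split; [| exists (gg_inverse star a) | rewrite (bc_inverseE bc)].
- move=> [/set_mem ga /set_mem gb e].
  have gaP := ggP _ ga; have gbP := group_inverseP gb.
  have prod := gg_product star_invol gaP gbP e.
  have [xab _ [u xu] _] := projection_bc_inverse gaP gbP e.
  split; last by rewrite group_ggE // (ggE _ _ prod).
  + split; first exact: mem_set ga.
    by apply: mem_set; exists (group_inverse b * gg_inverse star a); exact: prod.
  + exact: mem_set gb.
  + rewrite eqEsubset; split=> _ [z _ <-].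
      by exists (u * gg_inverse star a * z) => //; rewrite [in RHS]xu !mulrA.
    by exists (a * b * z) => //; rewrite !mulrA xab.
- move=> [[/set_mem ga /set_mem gab] /set_mem gb xAbA eab].
  split; [exact: mem_set ga | exact: mem_set gb |].
  apply: (gg_product_projection star_invol star_proper (ggP _ ga)
    (group_inverseP gb) xAbA).
  by rewrite -group_ggE // -eab; exact: ggP gab.
Qed.
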